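(* Let $D$ be an integral domain and let $\star$ be a semistar operation on $D$. Consider the following four propositions. (1) $\star$ is an eab operation. (2) $\star$ is an ab operation. (3) $\star$ is a $\mathcal W$-operation. (4) $\star$ is a complete $\mathcal W$-operation. Then $(4)\Rightarrow(3)\Rightarrow(2)\Rightarrow(1)$.
   Context: Let $D$ be an integral domain with quotient field $K$. $\overline{\boldsymbol F}(D)$ is the set of all nonzero $D$-submodules of $K$, and $\boldsymbol f(D)$ is the set of all nonzero finitely generated fractional ideals of $D$. A semistar operation of $D$ is a map $\star:\overline{\boldsymbol F}(D)\to\overline{\boldsymbol F}(D)$, $E\mapsto E^\star$, such that for all $0\ne z\in K$ and all $E,F\in\overline{\boldsymbol F}(D)$: $(zE)^\star=zE^\star$; $E\subseteq F$ implies $E^\star\subseteq F^\star$; $E\subseteq E^\star$ and $(E^\star)^\star=E^\star$. $\star$ is eab if, for all $F,G,H\in\boldsymbol f(D)$, $(FG)^\star\subseteq(FH)^\star$ implies $G^\star\subseteq H^\star$; $\star$ is ab if the same implication holds for all $F\in\boldsymbol f(D)$ and all $G,H\in\overline{\boldsymbol F}(D)$. For a family $\mathcal W$ of valuation overrings of $D$ (valuation domains between $D$ and $K$), $\wedge_{\mathcal W}$ is the semistar operation $E\mapsto\bigcap\{EW: W\in\mathcal W\}$. A $\mathcal W$-operation is a semistar operation equal to $\wedge_{\mathcal W}$ for some such family $\mathcal W$. A valuation overring $V$ of $D$ is a $\star$-valuation overring if $F^\star\subseteq FV$ for each $F\in\boldsymbol f(D)$; $b(\star)$ is the semistar operation $E\mapsto\bigcap\{EV: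 V\text{ a }\star\text{-valuation overring of }D\}$. A complete $\mathcal W$-operation is a semistar operation $\star$ such that $\star=b(\star)$ (equivalently, one of the form $b(\star')$ for some semistar operation $\star'$ on $D$). *)

(* Defs.v *)
From HB Require Import structures.
From mathcomp Require Import all_boot all_order all_algebra.
From mathcomp Require Import mathcomp_extra boolp classical_sets.

Set Implicit Arguments.
Unset Strict Implicit.
Unset Printing Implicit Defensive.

Import GRing.Theory.
Local Open Scope classical_set_scope.
Local Open Scope ring_scope.

Local Notation "x %:F" := (FracField.tofrac x).

Record Fbar (D : idomainType) := MkFbar {
  fbar_set :> set {fraction D};
  fbar_nonzero : exists2 x, fbar_set x & x != 0;
  fbar0 : fbar_set 0;
  fbarD : forall x y, fbar_set x -> fbar_set y -> fbar_set (x + y);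
  fbarZ : forall (a : D) x, fbar_set x -> fbar_set (a%:F * x)
}.

Lemma fbar_eq (D : idomainType) (E F : Fbar D) : E = F :> set _ -> E = F.
Proof.
case: E F => [E e1 e2 e3 e4] [F f1 f2 f3 f4] /= EF.
by subst F; congr MkFbar; apply: Prop_irrelevance.
Qed.

Definition fractional_ideal (D : idomainType) (E : Fbar D) : Prop :=
  exists2 d : D, d != 0 & forall x, fbar_set E x -> exists a : D, d%:F * x = a%:F.

Definition finitely_generated (D : idomainType) (E : Fbar D) : Prop :=
  exists (n : nat) (g : 'I_n -> {fraction D}),
    E = [set \sum_(i < n) (c i)%:F * g i | c in [set: 'I_n -> D]] :> set _.

(* Membership in f(D), as a predicate on Fbar(D). *)
Definition fg_fractional (D : idomainType) (E : Fbar D) : Prop :=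
  fractional_ideal E /\ finitely_generated E.

Section Products.
Variable D : idomainType.
Implicit Types (A B C : set {fraction D}) (E F : Fbar D).

(* Finite sums of products; this gives both the product of two D-submodules
   and the extension EV of a D-submodule E to an overring V. *)
Definition mulset A B : set {fraction D} :=
  [set x | exists2 s : seq ({fraction D} * {fraction D}),
     forall p, p \in s -> A p.1 /\ B p.2 & x = \sum_(p <- s) p.1 * p.2].

Lemma mulset_mem A B x y : A x -> B y -> mulset A B (x * y).
Proof.
move=> Ax By; exists [:: (x, y)]; last by rewrite big_seq1.
by move=> p; rewrite inE => /eqP ->.
Qed.

Lemma mulset0 A B : mulset A B 0.
Proof. by exists [::]; rewrite ?big_nil. Qed.

Lemma mulsetD A B x y : mulset A B x -> mulset A B y -> mulset A B (x + y).
Proof.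
move=> [s Hs ->] [t Ht ->]; exists (s ++ t); last by rewrite big_cat.
by move=> p; rewrite mem_cat => /orP[/Hs|/Ht].
Qed.

Lemma mulset_sub A B C : C 0 -> (forall x y, C x -> C y -> C (x + y)) ->
  (forall x y, A x -> B y -> C (x * y)) -> mulset A B `<=` C.
Proof.
move=> C0 CD CM x [s + ->]; elim: s => [|p s IH] H; first by rewrite big_nil.
rewrite big_cons; apply: CD.
  by have [] := H p (mem_head _ _); apply: CM.
by apply: IH => q qs; apply: H; rewrite inE qs orbT.
Qed.

Lemma mulsetZ E B (a : D) x : mulset E B x -> mulset E B (a%:F * x).
Proof.
move: x; apply: mulset_sub => [|x y Hx Hy|x y Ex By].
- by rewrite mulr0; exact: mulset0.
- by rewrite mulrDr; exact: mulsetD.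
- by rewrite mulrA; apply: mulset_mem => //; exact: fbarZ.
Qed.

Lemma mulset_nonzero E F : exists2 x, mulset E F x & x != 0.
Proof.
have [x Ex x0] := fbar_nonzero E; have [y Fy y0] := fbar_nonzero F.
by exists (x * y); [exact: mulset_mem | rewrite mulf_neq0].
Qed.

Definition fbar_mul E F : Fbar D :=
  MkFbar (mulset_nonzero E F) (@mulset0 E F) (@mulsetD E F) (@mulsetZ E F).

Section Scale.
Variables (z : {fraction D}) (z0 : z != 0) (E : Fbar D).

Let zE : set {fraction D} := [set z * x | x in E].

Let zE_nonzero : exists2 x, zE x & x != 0.
Proof.
have [x Ex x0] := fbar_nonzero E.
by exists (z * x); [exists x | rewrite mulf_neq0].
Qed.

Let zE0 : zE 0.
Proof. by exists 0; [exact: fbar0 | rewrite mulr0]. Qed.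

Let zED x y : zE x -> zE y -> zE (x + y).
Proof.
move=> [u Eu <-] [v Ev <-]; exists (u + v); last by rewrite mulrDr.
exact: fbarD.
Qed.

Let zEZ (a : D) x : zE x -> zE (a%:F * x).
Proof.
by move=> [u Eu <-]; exists (a%:F * u); [exact: fbarZ | rewrite mulrCA].
Qed.

Definition fbar_scale : Fbar D := MkFbar zE_nonzero zE0 zED zEZ.

End Scale.
End Products.

Record semistar (D : idomainType) := MkSemistar {
  star_op :> Fbar D -> Fbar D;
  star_scale : forall (z : {fraction D}) (z0 : z != 0) (E : Fbar D),
    star_op (fbar_scale z0 E) = fbar_scale z0 (star_op E);
  star_mono : forall E F : Fbar D, E `<=` F -> star_op E `<=` star_op F;
  star_ext : forall E : Fbar D, E `<=` star_op E;
  star_idem : forall E : Fbar D, star_op (star_op E) = star_op E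
}.

Definition eab (D : idomainType) (star : semistar D) : Prop :=
  forall F G H : Fbar D,
    fg_fractional F -> fg_fractional G -> fg_fractional H ->
    star (fbar_mul F G) `<=` star (fbar_mul F H) -> star G `<=` star H.

Definition ab (D : idomainType) (star : semistar D) : Prop :=
  forall F G H : Fbar D, fg_fractional F ->
    star (fbar_mul F G) `<=` star (fbar_mul F H) -> star G `<=` star H.

(* The quotient field of an overring of D is K, so such a ring is a valuation
   domain when it contains x or x^-1 for every nonzero x in K. *)
Record valuation_overring (D : idomainType) := MkValuationOverring {
  vo_set :> set {fraction D};
  vo_subring : subring_closed [in vo_set];
  vo_over : forall a : D, vo_set a%:F;
  vo_valuation : forall x, x != 0 -> vo_set x \/ vo_set x^-1
}.

Section Wedge.
Variables (D : idomainType) (W : set (valuation_overring D)).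
Implicit Types E F : Fbar D.

Let vo1 (V : valuation_overring D) : vo_set V 1.
Proof. by have [/set_mem] := vo_subring V. Qed.

Let voM (V : valuation_overring D) x y :
  vo_set V x -> vo_set V y -> vo_set V (x * y).
Proof.
by have [_ _ VM] := vo_subring V => Vx Vy; apply/set_mem/VM; exact/mem_set.
Qed.

Definition wedge_set E : set {fraction D} := \bigcap_(V in W) mulset E V.

Let wedge_ext E : E `<=` wedge_set E.
Proof. by move=> x Ex V _; rewrite -[x]mulr1; exact: mulset_mem. Qed.

Let wedge_nonzero E : exists2 x, wedge_set E x & x != 0.
Proof.
by have [x Ex x0] := fbar_nonzero E; exists x => //; exact: wedge_ext.
Qed.

Let wedge0 E : wedge_set E 0.
Proof. by move=> V _; exact: mulset0. Qed.

Let wedgeD E x y : wedge_set E x -> wedge_set E y -> wedge_set E (x + y).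
Proof. by move=> Hx Hy V WV; apply: mulsetD; [exact: Hx | exact: Hy]. Qed.

Let wedgeZ E (a : D) x : wedge_set E x -> wedge_set E (a%:F * x).
Proof. by move=> Hx V WV; apply: mulsetZ; exact: Hx. Qed.

Definition wedge_op E : Fbar D :=
  MkFbar (wedge_nonzero E) (wedge0 E) (@wedgeD E) (@wedgeZ E).

Let mulset_mul E (V : valuation_overring D) x y :
  mulset E V x -> vo_set V y -> mulset E V (x * y).
Proof.
move=> + Vy; move: x; apply: mulset_sub => [|x1 x2 H1 H2|x1 x2 H1 H2].
- by rewrite mul0r; exact: mulset0.
- by rewrite mulrDl; exact: mulsetD.
- by rewrite -mulrA; apply: mulset_mem => //; exact: voM.
Qed.

Let wedge_sub E F : E `<=` wedge_set F -> wedge_set E `<=` wedge_set F.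
Proof.
move=> EF x Ex V WV; move: (Ex V WV); move: x {Ex}.
apply: mulset_sub; [exact: mulset0 | exact: mulsetD |].
by move=> x y /EF /(_ V WV); exact: mulset_mul.
Qed.

Let wedge_scale (z : {fraction D}) (z0 : z != 0) E :
  wedge_op (fbar_scale z0 E) = fbar_scale z0 (wedge_op E).
Proof.
have sub (u : {fraction D}) (u0 : u != 0) F x V :
    mulset F V x -> mulset (fbar_scale u0 F) V (u * x).
  move: x; apply: mulset_sub => [|x y Hx Hy|x y Fx Vy].
  - by rewrite mulr0; exact: mulset0.
  - by rewrite mulrDr; exact: mulsetD.
  - by rewrite mulrA; apply: mulset_mem => //; exists x.
apply/fbar_eq/seteqP; split=> x /= Hx.
  exists (z^-1 * x); last by rewrite mulVKf.
  have zi0 : z^-1 != 0 by rewrite invr_eq0.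
  move=> V WV; have := sub _ zi0 _ _ _ (Hx V WV).
  have -> // : fbar_scale zi0 (fbar_scale z0 E) = E.
  apply/fbar_eq/seteqP; split=> y /=.
    by move=> [_ [w Ew <-] <-]; rewrite mulKf.
  by move=> Ey; exists (z * y); [exists y | rewrite mulKf].
by case: Hx => y Hy <- V WV; apply: sub; exact: Hy.
Qed.

Let wedge_mono E F : E `<=` F -> wedge_op E `<=` wedge_op F.
Proof. by move=> EF; apply: wedge_sub => x /EF; exact: wedge_ext. Qed.

Let wedge_idem E : wedge_op (wedge_op E) = wedge_op E.
Proof.
apply/fbar_eq/seteqP; split; first exact: wedge_sub.
exact: (@wedge_ext (wedge_op E)).
Qed.

Definition wedge : semistar D :=
  MkSemistar wedge_scale wedge_mono wedge_ext wedge_idem.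

End Wedge.

Definition W_operation (D : idomainType) (star : semistar D) : Prop :=
  exists W : set (valuation_overring D), star =1 wedge W.

Definition star_valuation_overring (D : idomainType) (star : semistar D)
    (V : valuation_overring D) : Prop :=
  forall F : Fbar D, fg_fractional F -> star F `<=` mulset F V.

Definition b (D : idomainType) (star : semistar D) : semistar D :=
  wedge [set V | star_valuation_overring star V].

Definition complete_W_operation (D : idomainType) (star : semistar D) : Prop :=
  star =1 b star.

(* Main.v *)
(**
  If F is finitely generated and V is a valuation overring, the generator f of
  F of least V-value satisfies F V = f V. Hence for f g in (F H) V = f H V we
  can cancel f, and g lies in H V; intersecting over the family of valuation
  overrings gives the ab property.
*)
Require Import Defs.
From mathcomp Require Import all_boot all_algebra.
From mathcomp Require Import boolp classical_sets.

Set Implicit Arguments.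
Unset Strict Implicit.
Unset Printing Implicit Defensive.

Import GRing.Theory.
Local Open Scope classical_set_scope.
Local Open Scope ring_scope.

Section ValuationOverring.
Variables (D : idomainType) (V : valuation_overring D).

Lemma vo1 : vo_set V 1.
Proof. by have [/set_mem] := vo_subring V. Qed.

Lemma voB x y : vo_set V x -> vo_set V y -> vo_set V (x - y).
Proof.
by have [_ VB _] := vo_subring V => Vx Vy; apply/set_mem/VB; exact/mem_set.
Qed.

Lemma voM x y : vo_set V x -> vo_set V y -> vo_set V (x * y).
Proof.
by have [_ _ VM] := vo_subring V => Vx Vy; apply/set_mem/VM; exact/mem_set.
Qed.

Lemma vo0 : vo_set V 0.
Proof. by rewrite -(subrr 1); apply: voB; exact: vo1. Qed.

Lemma voD x y : vo_set V x -> vo_set V y -> vo_set V (x + y).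
Proof.
move=> Vx Vy; rewrite -[y]opprK; apply: voB => //; rewrite -sub0r.
by apply: voB => //; exact: vo0.
Qed.

(** For nonzero [x] and [y], apply the valuation property to [y / x]. A zero element is the product
    of any other with 0. *)
Lemma vo_dvd_total x y :
  (exists2 v, vo_set V v & y = x * v) \/ (exists2 v, vo_set V v & x = y * v).
Proof.
have [->|x0] := eqVneq x 0.
  by right; exists 0; [exact: vo0 | rewrite mulr0].
have [->|y0] := eqVneq y 0.
  by left; exists 0; [exact: vo0 | rewrite mulr0].
have /(vo_valuation V)[Vyx|] : y / x != 0 by rewrite mulf_neq0 ?invr_eq0.
  by left; exists (y / x); rewrite // mulrC divfK.
by rewrite invf_div => Vxy; right; exists (x / y); rewrite // mulrC divfK.
Qed.

(** Induction on the list: the divisor found for the tail is compared with the new head, and the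
    winner divides everything by transitivity. *)
Lemma vo_dvd_all x s : exists2 f, f \in x :: s &
  forall y, y \in x :: s -> exists2 v, vo_set V v & y = f * v.
Proof.
elim: s x => [|z s IH] x.
  exists x; first exact: mem_head.
  by move=> y /[!inE] /eqP ->; exists 1; [exact: vo1 | rewrite mulr1].
have [f fzs fP] := IH z; have [[v Vv xE]|[v Vv fE]] := vo_dvd_total f x.
  exists f; first by rewrite inE fzs orbT.
  by move=> y; rewrite inE => /predU1P[->|/fP//]; exists v.
exists x; first exact: mem_head.
move=> y; rewrite inE => /predU1P[->|/fP[w Vw ->]].
  by exists 1; [exact: vo1 | rewrite mulr1].
by exists (v * w); [exact: voM | rewrite fE mulrA].
Qed.

Lemma finitely_generated_vo_principal (F : Fbar D) : finitely_generated F ->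
  exists f, [/\ fbar_set F f, f != 0 &
    forall x, fbar_set F x -> exists2 v, vo_set V v & x = f * v].
Proof.
move=> [n [g FE]]; have [x0 Fx0 x0_neq0] := fbar_nonzero F.
have Fg i : fbar_set F (g i).
  (* Kronecker delta coefficients single out the generator [g i]. *)
  rewrite FE; exists (fun j => (j == i)%:R) => //.
  rewrite (bigD1 i)//= eqxx rmorph1 mul1r big1 ?addr0// => j /negPf ->.
  by rewrite rmorph0 mul0r.
(* Nonvanishing is automatic: [f] divides the nonzero element [x0]. *)
suff [f Ff fP] : exists2 f, fbar_set F f &
    forall x, fbar_set F x -> exists2 v, vo_set V v & x = f * v.
  exists f; split=> //; apply: contraNneq x0_neq0 => f0.
  by have [v _ ->] := fP _ Fx0; rewrite f0 mul0r.
(* With no generators every combination is an empty sum, so 0 serves as [f]. *)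
case gE : (codom g) => [|y s].
  exists 0; first exact: fbar0.
  move=> x; rewrite FE => -[c _ <-]; exists 0; first exact: vo0.
  rewrite mulr0 big1// => i _.
  by have := codom_f g i; rewrite gE.
have [f] := vo_dvd_all y s; rewrite -gE => /codomP[i ->] fP.
exists (g i) => // x; rewrite FE => -[c _ <-].
elim/big_ind: _ => [|_ _ [v Vv ->] [w Vw ->]|j _].
- by exists 0; [exact: vo0 | rewrite mulr0].
- by exists (v + w); [exact: voD | rewrite mulrDr].
have [v Vv ->] := fP _ (codom_f g j).
by exists (FracField.tofrac (c j) * v);
  [apply: voM => //; exact: vo_over | rewrite mulrCA].
Qed.

Lemma mulset_vo_mul (E : set {fraction D}) x y :
  mulset E V x -> vo_set V y -> mulset E V (x * y).
Proof.
move=> + Vy; move: x; apply: mulset_sub => [|x1 x2 H1 H2|x1 x2 H1 H2].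
- by rewrite mul0r; exact: mulset0.
- by rewrite mulrDl; exact: mulsetD.
- by rewrite -mulrA; apply: mulset_mem => //; exact: voM.
Qed.

Lemma mulset_vo_cancel (F G H : Fbar D) : finitely_generated F ->
  fbar_mul F G `<=` mulset (fbar_mul F H) V -> G `<=` mulset H V.
Proof.
move=> /finitely_generated_vo_principal[f [Ff f0 fP]] FGH g Gg.
(* This is f(HV), written as a preimage so that cancelling [f] is immediate. It is an additive
   target for [mulset_sub], used once for (FH)V and once for FH. *)
pose fHV := [set x | mulset H V (f^-1 * x)].
have fHV0 : fHV 0 by rewrite /fHV /= mulr0; exact: mulset0.
have fHVD x y : fHV x -> fHV y -> fHV (x + y).
  by rewrite /fHV /= mulrDr; exact: mulsetD.
suff /(_ (f * g)) : mulset (fbar_mul F H) V `<=` fHV.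
  by rewrite /fHV /= mulKf//; apply; apply: FGH; exact: mulset_mem.
apply: mulset_sub => // x y FHx Vy.
rewrite /fHV /= mulrA; apply: mulset_vo_mul => //.
(* An element of F is [f * v] with [v] in V, so dividing its product with [h] by [f] leaves
   [h * v]. *)
move: x FHx; apply: (@mulset_sub _ _ _ fHV) => // x h /fP[v Vv ->] Hh.
by rewrite /fHV /= -mulrA mulKf// mulrC; exact: mulset_mem.
Qed.

End ValuationOverring.

Lemma wedge_ab (D : idomainType) (W : set (valuation_overring D)) :
  ab (wedge W).
Proof.
(* Idempotence and monotonicity reduce the goal to the inclusion of G itself in the closure of H,
   which is checked at each V of the family. *)
move=> F G H [_ Ffg] FGH; rewrite -(star_idem (wedge W) H).
apply: star_mono => g Gg; change (wedge_set W H g) => V WV.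
apply: mulset_vo_cancel Ffg _ _ Gg => x FGx.
exact: FGH (star_ext (wedge W) FGx) V WV.
Qed.

Theorem proposition7 (D : idomainType) (star : semistar D) :
  (complete_W_operation star -> W_operation star) /\
  (W_operation star -> ab star) /\
  (ab star -> eab star).
Proof.
(* By definition [b star] is the wedge over this family. *)
split; first by move=> starE; exists [set V | star_valuation_overring star V].
split; last by move=> star_ab F G H Ffg _ _; exact: star_ab.
by move=> [W starE] F G H; rewrite !starE; exact: wedge_ab.
Qed.
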